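(* Let $\mathcal{X}=\{X_1,\dots,X_m\}$ and $\mathcal{Y}=\{Y_1,\dots,Y_n\}$ be disjoint alphabets and $\mu:\mathbb{C}\langle\mathcal{X}\cup\mathcal{Y}\rangle\to\mathbb{C}$ a unital linear functional with respect to which $\mathbb{C}\langle\mathcal{X}\rangle$ and $\mathbb{C}\langle\mathcal{Y}\rangle$ are free. Then for every $P\in\mathbb{C}\langle\mathcal{X}\cup\mathcal{Y}\rangle$: (i) $$\beta^b_{\mathcal{X}}(P)=\epsilon(P)+(\beta^\delta_{\mathcal{X}}\otimes\beta^b_{\mathcal{X}})(\overleftarrow\delta_{\mathcal{X}}P)=\epsilon(P)+(\beta^b_{\mathcal{X}}\otimes\beta^\delta_{\mathcal{X}})(\overrightarrow\delta_{\mathcal{X}}P).$$ (ii) $$\beta^\delta_{\mathcal{X}}(P)=\epsilon(P)+\sum_{k=1}^\infty\ \sum_{i_1,\dots,i_k\in\{1,\dots,m\}}\beta_k(X_{i_1},\dots,X_{i_k})\,\bigl[\epsilon\otimes(\beta^b_{\mathcal{Y}})^{\otimes(k-1)}\otimes\epsilon\bigr]\bigl(\partial_{X_{i_1}}\partial_{X_{i_2}}\cdots\partial_{X_{i_k}}P\bigr).$$ In particular, when $\mathcal{X}=\{X\}$ consists of a single variable, $$\beta^\delta_X(P)=\epsilon(P)+\sum_{k=1}^\infty\beta_k(X)\bigl[\epsilon\otimes(\beta^b_{\mathcal{Y}})^{\otimes(k-1)}\otimes\epsilon\bigr](\partial_X^kP).$$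
   Context: $\mathbb{C}\langle\mathcal{X}\cup\mathcal{Y}\rangle$ is the free unital algebra; $\epsilon(P)=P(0)$ is the constant coefficient. Freeness: $\mu(u_1\cdots u_r)=0$ whenever $r\geq 1$, $\mu(u_j)=0$ for all $j$ and the $u_j$ come alternatingly from $\mathbb{C}\langle\mathcal{X}\rangle$ and $\mathbb{C}\langle\mathcal{Y}\rangle$. Boolean cumulants: multilinear functionals $\beta_n$ with $\mu(a_1\cdots a_n)=\sum_{k=1}^n\beta_k(a_1,\dots,a_k)\mu(a_{k+1}\cdots a_n)$ (empty product $=1$); $\beta_k(X)=\beta_k(X,\dots,X)$. Block cumulants: $\beta^b_{\mathcal{X}}$ is the linear functional on $\mathbb{C}\langle\mathcal{X}\cup\mathcal{Y}\rangle$ with $\beta^b_{\mathcal{X}}(1)=1$, $\beta^b_{\mathcal{X}}(u_1v_1u_2\cdots v_{r-1}u_r)=\beta_{2r-1}(u_1,v_1,u_2,\dots,v_{r-1},u_r)$ for non-empty words $u_i$ in $\mathcal{X}$ and $v_i$ in $\mathcal{Y}$, and $\beta^b_{\mathcal{X}}(w)=0$ for every non-empty word $w$ which starts or ends with a letter of $\mathcal{Y}$. $\beta^b_{\mathcal{Y}}$ is defined in the same way with the roles of $\mathcal{X}$ and $\mathcal{Y}$ exchanged. Fully factored cumulants: $\beta^\delta_{\mathcal{X}}$ is the linear functional with $\beta^\delta_{\mathcal{X}}(1)=1$ and, for a word $w=w_1\cdots w_k$ with letters $w_j\in\mathcal{X}\cup\mathcal{Y}$, $k\ge1$, $\beta^\delta_{\mathcal{X}}(w)=\beta_k(w_1,\dots,w_k)$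 if $w_1,w_k\in\mathcal{X}$ and $\beta^\delta_{\mathcal{X}}(w)=0$ otherwise. Derivations (linear maps into $\mathbb{C}\langle\mathcal{X}\cup\mathcal{Y}\rangle\otimes\mathbb{C}\langle\mathcal{X}\cup\mathcal{Y}\rangle$), on words $w=w_1\cdots w_k$: $\overleftarrow\delta_{\mathcal{X}}(w)=\sum_{j:w_j\in\mathcal{X}}w_1\cdots w_j\otimes w_{j+1}\cdots w_k$, $\ \overrightarrow\delta_{\mathcal{X}}(w)=\sum_{j:w_j\in\mathcal{X}}w_1\cdots w_{j-1}\otimes w_j\cdots w_k$, and the free difference quotient $\partial_{X_i}(w)=\sum_{j:w_j=X_i}w_1\cdots w_{j-1}\otimes w_{j+1}\cdots w_k$ (all vanish on $1$). Iterated derivatives act on the leftmost tensor leg: $\partial_{X_{i_1}}\cdots\partial_{X_{i_k}}P=(\partial_{X_{i_1}}\otimes\mathrm{id}^{\otimes(k-1)})\cdots(\partial_{X_{i_{k-1}}}\otimes\mathrm{id})\partial_{X_{i_k}}P$, an element of the $(k+1)$-fold tensor power; on a word it is the sum of $w^{(0)}\otimes w^{(1)}\otimes\cdots\otimes w^{(k)}$ over all factorizations $w=w^{(0)}X_{i_1}w^{(1)}X_{i_2}\cdots X_{i_k}w^{(k)}$. *)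

(* Defs.v *)
(* The free algebra K<X u Y> is multinomials' monoid algebra of
   the free monoid over the letters; the alphabets {X_1, ..., X_m} and
   {Y_1, ..., Y_n} are the two summands of 'I_m + 'I_n. *)
From HB Require Import structures.
From mathcomp Require Import all_boot all_order all_algebra.
From mathcomp Require Import finmap.
From mathcomp Require Import reals.
From mathcomp.multinomials Require Import monalg.
From mathcomp.real_closed Require Import complex.

Set Implicit Arguments.
Unset Strict Implicit.
Unset Printing Implicit Defensive.

Import GRing.Theory.
Local Open Scope ring_scope.

Section LinearExtension.
Variables (K : comNzRingType) (B : choiceType) (V : lmodType K).

Definition linext (f : B -> V) (P : {malg K[B]}) : V :=
  \sum_(b <- msupp P) P@_b *: f b.

Lemma linextEw (f : B -> V) (d : {fset B}) (P : {malg K[B]}) :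
  (msupp P `<=` d)%fset -> linext f P = \sum_(b <- d) P@_b *: f b.
Proof.
move=> le; rewrite /linext (big_fset_incl _ le) // => b _ bP.
by rewrite mcoeff_outdom // scale0r.
Qed.

Lemma linext_is_linear (f : B -> V) : linear (linext f).
Proof.
move=> c P Q; pose d := (msupp P `|` msupp Q `|` msupp (c *: P + Q))%fset.
have lP : (msupp P `<=` d)%fset by rewrite /d -fsetUA fsubsetUl.
have lQ : (msupp Q `<=` d)%fset.
  by rewrite /d [X in (X `|` _)%fset]fsetUC -fsetUA fsubsetUl.
have lR : (msupp (c *: P + Q) `<=` d)%fset by rewrite /d fsubsetUr.
rewrite (linextEw f lP) (linextEw f lQ) (linextEw f lR) scaler_sumr -big_split.
by apply: eq_bigr => b _; rewrite mcoeffD mcoeffZ scalerDl scalerA.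
Qed.

HB.instance Definition _ (f : B -> V) :=
  GRing.isLinear.Build K {malg K[B]} V _ (linext f) (linext_is_linear f).

Lemma linextU (f : B -> V) (b : B) : linext f << b >> = f b.
Proof.
by rewrite (linextEw f msuppU_le) big_seq_fset1 mcoeffUU scale1r.
Qed.

End LinearExtension.

Section Words.
Variables (K : comNzRingType) (L : choiceType).

Notation alg := {malg K[{fmonom L}]}.

Definition word (w : seq L) : alg := << FMonom w >>.

Definition letter (a : L) : alg := word [:: a].

Definition eps (P : alg) : K := P@_(FMonom [::]).

(* The subset of letters satisfying p plays the role of one of the two
   alphabets, and its complement that of the other one. *)

Definition subalg (p : pred L) (P : alg) : Prop :=
  forall w : {fmonom L}, w \in msupp P -> all p w.

(* The boolean b says from which of the two subalgebras u_1 is taken. *)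
Definition free_sides (p : pred L) (mu : alg -> K) : Prop :=
  forall (b : bool) (s : seq alg), s != [::] ->
    (forall j, (j < size s)%N ->
       subalg (fun a => p a == b (+) odd j) s`_j /\ mu s`_j = 0) ->
  mu (\prod_(u <- s) u) = 0.

(* beta [:: a_1; ...; a_n] stands for beta_n(a_1, ..., a_n); the value
   beta [::] is irrelevant. *)
Definition boolean_cumulants (mu : alg -> K) (beta : seq alg -> K) : Prop :=
  (forall (s1 s2 : seq alg) (c : K) (a b : alg),
     beta (s1 ++ (c *: a + b) :: s2) =
     c * beta (s1 ++ a :: s2) + beta (s1 ++ b :: s2)) /\
  (forall s : seq alg, s != [::] ->
     mu (\prod_(a <- s) a) =
     \sum_(1 <= k < (size s).+1)
        beta (take k s) * mu (\prod_(a <- drop k s) a)).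

Definition ends_in (p : pred L) (w : seq L) : bool :=
  if w is a :: w' then p a && p (last a w') else false.

(* The decomposition of a word into its maximal blocks of letters lying all
   in p or all outside p, see runs_alternating below. *)
Fixpoint runs (p : pred L) (w : seq L) : seq (seq L) :=
  if w is a :: w' then
    match runs p w' with
    | (b :: u) :: t =>
        if p a == p b then (a :: b :: u) :: t else [:: a] :: (b :: u) :: t
    | t => [:: a] :: t
    end
  else [::].

Definition block_cumulant (p : pred L) (beta : seq alg -> K) : alg -> K :=
  linext (V := K^o) (fun w : {fmonom L} =>
    if (w : seq L) == [::] then 1
    else if ends_in p w then beta [seq word u | u <- runs p w] else 0).

Definition delta_cumulant (p : pred L) (beta : seq alg -> K) : alg -> K :=
  linext (V := K^o) (fun w : {fmonom L} =>
    if (w : seq L) == [::] then 1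
    else if ends_in p w then beta [seq letter a | a <- w] else 0).

(* The k-fold tensor power of the free algebra, as the free module on
   k-tuples of words: << [tuple w_1; ...; w_k] >> is w_1 (x) ... (x) w_k. *)
Notation tens k := {malg K[k.-tuple {fmonom L}]}.

Definition tens_fun k (f : 'I_k -> alg -> K) : tens k -> K :=
  linext (V := K^o) (fun t : k.-tuple {fmonom L} => \prod_(j < k) f j << tnth t j >>).

Definition tens2 (f g : alg -> K) : tens 2 -> K :=
  tens_fun (fun j : 'I_2 => if j == 0%N :> nat then f else g).

(* f (x) g^(x)(k-1) (x) f, for k > 0 *)
Definition tens_ends k (f g : alg -> K) : tens k.+1 -> K :=
  tens_fun (fun j : 'I_k.+1 =>
    if (j == 0%N :> nat) || (j == k :> nat) then f else g).

Definition left_delta (p : pred L) : alg -> tens 2 :=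
  linext (fun w : {fmonom L} =>
    \sum_(j < size w | p (tnth (in_tuple w) j))
       << [tuple FMonom (take j.+1 w); FMonom (drop j.+1 w)] >>).

Definition right_delta (p : pred L) : alg -> tens 2 :=
  linext (fun w : {fmonom L} =>
    \sum_(j < size w | p (tnth (in_tuple w) j))
       << [tuple FMonom (take j w); FMonom (drop j w)] >>).

(* The operator d_a (x) id^(x)k, where d_a is the free difference quotient
   with respect to the letter a. *)
Definition fdq_left (a : L) k : tens k.+1 -> tens k.+2 :=
  linext (fun t : k.+1.-tuple {fmonom L} =>
    let w := thead t in
    \sum_(j < size w | tnth (in_tuple w) j == a)
       << [tuple of FMonom (take j w) :: FMonom (drop j.+1 w) :: behead t] >>).

(* iter_fdq [:: a_1; ...; a_k] P is d_{a_1} ... d_{a_k} P *)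
Fixpoint iter_fdq (s : seq L) (P : alg) : tens (size s).+1 :=
  match s return tens (size s).+1 with
  | [::] => linext (fun w : {fmonom L} => << [tuple w] >>) P
  | a :: s' => fdq_left a (iter_fdq s' P)
  end.

(* S is the sum of the F k over k >= 1, all but finitely many being 0. *)
Definition has_finsum (F : nat -> K) (S : K) : Prop :=
  exists N, (forall k, (N < k)%N -> F k = 0) /\ S = \sum_(1 <= k < N.+1) F k.

Fixpoint alternating (p : pred L) (b : bool) (ss : seq (seq L)) : bool :=
  if ss is u :: t then
    [&& u != [::], all (fun a => p a == b) u & alternating p (~~ b) t]
  else true.

Lemma runs_alternating p b ss : alternating p b ss -> runs p (flatten ss) = ss.
Proof.
elim: ss b => [|u ss IH] b //= /and3P[+ + alt].
rewrite -/(flatten _).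
elim: u => [|a u IHu] // _ /= /andP[/eqP pa].
case: u IHu => [|c u] IHu pu.
  rewrite /= (IH _ alt); case: ss alt {IH IHu} => [|[|d v] ss] //=.
  by case/andP=> /andP[/eqP pd _] _; rewrite pa pd; case: (b).
have pc : p c = b by case/andP: pu => /eqP.
by rewrite (IHu isT pu) pa pc eqxx.
Qed.

(* Existence of Boolean cumulants; uniqueness on non-empty sequences is clear
   from the moment relation. *)
Fixpoint bcum_from (mu : alg -> K) (a : alg) (s : seq alg) : K :=
  if s is b :: s' then bcum_from mu (a * b) s' - mu a * bcum_from mu b s'
  else mu a.

Definition bcum (mu : alg -> K) (s : seq alg) : K :=
  if s is a :: s' then bcum_from mu a s' else 0.

Lemma bcumP (mu : {scalar alg}) : mu 1 = 1 -> boolean_cumulants mu (bcum mu).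
Proof.
move=> mu1.
have mulZ (c : K) (a b : alg) : a * (c *: b) = c *: (a * b).
  apply/malgP => k; rewrite mcoeffZ (mcoeffMlw _ (fsubset_refl _) (msuppZ_le c b)).
  rewrite mcoeffMl mulr_sumr.
  apply: eq_bigr => u _; rewrite mulr_sumr; apply: eq_bigr => v _.
  by rewrite mcoeffZ mulrnAr mulrCA.
have linl s c a b : bcum_from mu (c *: a + b) s =
    c * bcum_from mu a s + bcum_from mu b s.
  elim: s a b => [|d s IH] a b /=; first by rewrite linearP.
  rewrite mulrDl -scalerAl IH linearP mulrDl opprD mulrBr addrACA.
  by rewrite mulrA.
have linr s1 s2 c a b d : bcum_from mu d (s1 ++ (c *: a + b) :: s2) =
    c * bcum_from mu d (s1 ++ a :: s2) + bcum_from mu d (s1 ++ b :: s2).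
  elim: s1 d => [|e s1 IH] d /=.
    rewrite mulrDr mulZ !linl mulrDr opprD mulrBr addrACA.
    by rewrite mulrCA.
  by rewrite !IH mulrDr opprD mulrBr addrACA mulrCA.
split=> [[|d s1] s2 c a b /=|[|a s] // _]; [exact: linl|exact: linr|].
elim: s a => [|b s IH] a.
  by rewrite big_nat1 /= big_cons !big_nil mulr1 mu1 mulr1.
have -> : \prod_(x <- [:: a, b & s]) x = \prod_(x <- a * b :: s) x.
  by rewrite !big_cons mulrA.
rewrite IH !big_add1 /=.
rewrite [in RHS]big_nat_recl //= IH big_add1 mulr_sumr -big_split /=.
by apply: eq_bigr => k _; rewrite mulrBl -mulrA addrC subrK.
Qed.

End Words.

Arguments eps {K L} P.

Definition isX m n (a : 'I_m + 'I_n) : bool := if a is inl _ then true else false.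
Definition isY m n (a : 'I_m + 'I_n) : bool := if a is inr _ then true else false.

Arguments isX {m n} a.
Arguments isY {m n} a.

Notation ncpoly K m n := {malg K[{fmonom ('I_m + 'I_n)%type}]}.

(* Main.v *)
(* Functionals on words are formal power series in the letters, multiplied by
   the Cauchy product [conv].  Let B_X (B_Y) be the series of the Boolean
   cumulants of the words with both ends in X (Y).

   Every list with entries from the two subalgebras can be reduced to centred
   alternating lists by multiplying adjacent entries from the same side and by
   splitting each entry into a centred part and a scalar; the Boolean cumulants
   of centred alternating lists vanish by freeness.  Two facts follow by
   induction along this reduction: cumulants with ends on different sides
   vanish, and
     beta(x_1, ..., x_k, s) = \sum_(s = h s') B_Y(h) beta(x_1, ..., x_k, s')
   when all the x_i are on the side X and s starts on the side Y.

   Splitting the blocks of a word letter by letter, the first fact gives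
   bX = 1 + B_X bX.  Hence bX is the two-sided inverse of 1 - B_X, which is (i).
   Solving the second fact for the tail by means of bY = (1 - B_Y)^-1 shows that
   the gap before the next chosen letter of X contributes a factor bY; iterating
   over the letters of X gives (ii). *)
Require Import Defs.
From mathcomp Require Import all_boot all_order all_algebra.
From mathcomp Require Import finmap ring.
From mathcomp Require Import reals.
From mathcomp.multinomials Require Import monalg.
From mathcomp.real_closed Require Import complex.

Set Implicit Arguments.
Unset Strict Implicit.
Unset Printing Implicit Defensive.

Import GRing.Theory.
Local Open Scope ring_scope.

(** * Cauchy product of functionals on words *)

Section Convolution.
Variables (K : comNzRingType) (T : Type).
Implicit Types (f g h : seq T -> K) (s : seq T).

Definition conv f g s : K :=
  \sum_(j < (size s).+1) f (take j s) * g (drop j s).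

Definition conv_one s : K := (nilp s)%:R.

(** The value of [beta] at the empty list is unspecified; it is replaced by 0 before [beta] enters a
    Cauchy product. *)
Definition reduced f s : K := if nilp s then 0 else f s.

Lemma reducedE f s1 x s2 : reduced f (s1 ++ x :: s2) = f (s1 ++ x :: s2).
Proof. by case: s1. Qed.

Lemma conv_nil f g : conv f g [::] = f [::] * g [::].
Proof. by rewrite /conv big_ord_recl big_ord0 addr0. Qed.

Lemma conv_cons f g a s :
  conv f g (a :: s) = f [::] * g (a :: s) + conv (fun u => f (a :: u)) g s.
Proof. by rewrite /conv big_ord_recl. Qed.

Lemma eq_conv f f' g g' : f =1 f' -> g =1 g' -> conv f g =1 conv f' g'.
Proof. by move=> ef eg s; apply: eq_bigr => j _; rewrite ef eg. Qed.

Lemma convDl f f' g s :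
  conv (fun u => f u + f' u) g s = conv f g s + conv f' g s.
Proof. by rewrite -big_split; apply: eq_bigr => j _; rewrite mulrDl. Qed.

Lemma convDr f g g' s :
  conv f (fun u => g u + g' u) s = conv f g s + conv f g' s.
Proof. by rewrite -big_split; apply: eq_bigr => j _; rewrite mulrDr. Qed.

Lemma convZl c f g s : conv (fun u => c * f u) g s = c * conv f g s.
Proof. by rewrite mulr_sumr; apply: eq_bigr => j _; rewrite mulrA. Qed.

Lemma convZr c f g s : conv f (fun u => c * g u) s = c * conv f g s.
Proof. by rewrite mulr_sumr; apply: eq_bigr => j _; rewrite mulrCA. Qed.

Lemma conv_sumr (I : Type) (r : seq I) (Q : pred I) f (G : I -> seq T -> K) s :
  conv f (fun u => \sum_(i <- r | Q i) G i u) s =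
  \sum_(i <- r | Q i) conv f (G i) s.
Proof. by rewrite exchange_big; apply: eq_bigr => j _; rewrite mulr_sumr. Qed.

Lemma conv0l f g s : f =1 (fun=> 0) -> conv f g s = 0.
Proof. by move=> f0; apply: big1 => j _; rewrite f0 mul0r. Qed.

Lemma conv0r f g s : g =1 (fun=> 0) -> conv f g s = 0.
Proof. by move=> g0; apply: big1 => j _; rewrite g0 mulr0. Qed.

Lemma conv1l g s : conv conv_one g s = g s.
Proof.
case: s => [|a s]; first by rewrite conv_nil mul1r.
by rewrite conv_cons mul1r conv0l ?addr0.
Qed.

Lemma conv1r f s : conv f conv_one s = f s.
Proof.
elim: s f => [|a s IH] f; first by rewrite conv_nil mulr1.
by rewrite conv_cons mulr0 add0r IH.
Qed.

Lemma convA f g h s : conv (conv f g) h s = conv f (conv g h) s.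
Proof.
elim: s f g => [|a s IH] f g; first by rewrite !conv_nil mulrA.
rewrite !conv_cons conv_nil -IH mulrDr mulrA -addrA; congr (_ + _).
rewrite -convZl -convDl; apply: eq_conv => // u.
exact: conv_cons.
Qed.

Lemma conv_mid f g s1 x s2 : conv f g (s1 ++ x :: s2) =
  conv f (fun u => g (u ++ x :: s2)) s1 +
  conv (fun u => f (s1 ++ x :: u)) g s2.
Proof.
elim: s1 f => [|a s1 IH] f /=; first by rewrite conv_nil conv_cons.
by rewrite !conv_cons IH addrA.
Qed.

(** The cut between [s1] and [s2] occurs in both terms on the right, hence the extra product on the
    left. *)
Lemma conv_cat f g s1 s2 : conv f g (s1 ++ s2) + f s1 * g s2 =
  conv f (fun u => g (u ++ s2)) s1 + conv (fun u => f (s1 ++ u)) g s2.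
Proof.
elim: s1 f => [|a s1 IH] f /=; first by rewrite conv_nil addrC.
by rewrite !conv_cons -!addrA IH.
Qed.

(** The hypothesis gives f b = b + b (f b). As [b [::] = 0], the inner f b is only met on shorter
    words, where induction turns it into f - 1; what remains is b f. *)
Lemma conv_inv_sym f b : b [::] = 0 ->
    (forall s, f s = conv_one s + conv b f s) ->
  forall s, f s = conv_one s + conv f b s.
Proof.
move=> b0 fE s; have [n] := ubnP (size s); elim: n s => // n IH s ltsn.
have -> : conv f b s = b s + conv b (conv f b) s.
  by rewrite -(conv1l b s) -convA -convDl; exact: eq_conv.
have -> : conv b (conv f b) s = conv b (fun u => f u - conv_one u) s.
  case: s ltsn => [|a s] ltsn; first by rewrite !conv_nil b0 !mul0r.
  rewrite !conv_cons b0 !mul0r !add0r; apply: eq_bigr => j _; congr (_ * _).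
  rewrite [in RHS]IH; first by rewrite addrC addKr.
  move: ltsn; rewrite ltnS; apply: leq_trans.
  by rewrite ltnS size_drop leq_subr.
have -> : conv b (fun u => f u - conv_one u) s =
    conv b f s + -1 * conv b conv_one s.
  by rewrite -convZr -convDr; apply: eq_conv => // u; rewrite mulN1r.
by rewrite conv1r fE; ring.
Qed.

End Convolution.

Arguments conv_one {K T} s.

Lemma conv_map (K : comNzRingType) (T T' : Type) (h : T' -> T)
    (f g : seq T -> K) (s : seq T') :
  conv f g (map h s) = conv (fun u => f (map h u)) (fun u => g (map h u)) s.
Proof.
elim: s f => [|a s IH] f; first by rewrite !conv_nil.
by rewrite /= !conv_cons IH.
Qed.

(** * Boolean cumulants of free subalgebras *)

Section Freeness.
Variables (K : comNzRingType) (L : choiceType).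
Notation alg := {malg K[{fmonom L}]}.
Variables (p : pred L) (mu : {scalar alg}) (beta : seq alg -> K).
Hypothesis mu1 : mu 1 = 1.
Hypothesis mu_free : free_sides p mu.
Hypothesis betaP : boolean_cumulants mu beta.
Implicit Types (s : seq alg) (t : seq (bool * alg)).

Lemma subalg1 (q : pred L) : subalg q (1 : alg).
Proof.
move=> w; rewrite -mcoeff_neq0 mcoeff1.
by case: (w =P mone) => [->|]; rewrite ?eqxx // fm1.
Qed.

Lemma subalgM (q : pred L) (u v : alg) :
  subalg q u -> subalg q v -> subalg q (u * v).
Proof.
move=> qu qv w /msuppM_le[w1 [w2 [/qu q1 /qv q2 ->]]].
by rewrite fmM all_cat q1.
Qed.

Lemma subalgBZ (q : pred L) (u v : alg) c :
  subalg q u -> subalg q v -> subalg q (u - c *: v).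
Proof.
move=> qu qv w /(fsubsetP (msuppB_le _ _)); rewrite inE => /orP[/qu //|].
by move/(fsubsetP (msuppZ_le _ _))/qv.
Qed.

Lemma subalg_letter (q : pred L) a : q a -> subalg q (letter K a).
Proof. by move=> qa w; rewrite msuppU1 inE => /eqP ->; rewrite /= qa. Qed.

Lemma beta_linear s1 s2 c u v : beta (s1 ++ (c *: u + v) :: s2) =
  c * beta (s1 ++ u :: s2) + beta (s1 ++ v :: s2).
Proof. by case: betaP. Qed.

(** The top term of the moment relation is [beta s] times [mu 1 = 1], so the relation determines
    [beta s] from shorter lists. Identities for [beta] can thus be computed on the explicit
    [bcum]. *)
Lemma beta_bcum s : s != [::] -> beta s = bcum mu s.
Proof.
have [n] := ubnP (size s); elim: n s => // n IH s ltsn s0.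
have [_ /(_ _ s0) bmom] := bcumP mu1.
have [_ /(_ _ s0)] := betaP; rewrite bmom !big_nat_recr ?lt0n ?size_eq0 //=.
rewrite take_size drop_size big_nil mu1 !mulr1.
rewrite (eq_big_nat _ _ (F2 := fun k =>
  beta (take k s) * mu (\prod_(a <- drop k s) a))).
  by move/addrI.
move=> k /andP[k0 ks]; rewrite IH //.
  by rewrite (size_takel (ltnW ks)) (leq_trans ks).
by rewrite -size_eq0 (size_takel (ltnW ks)) -lt0n.
Qed.

Lemma bcum_from_merge a s1 u v s2 :
  bcum_from mu a (s1 ++ u * v :: s2) = bcum_from mu a (s1 ++ u :: v :: s2) +
    bcum_from mu a (s1 ++ [:: u]) * bcum_from mu v s2.
Proof.
elim: s1 a => [|b s1 IH] a /=; last by rewrite !IH; ring.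
have aux (A B C x y z : K) :
    A - x * B = A - z * C - x * (B - y * C) + (z - x * y) * C by ring.
by rewrite !mulrA; exact: aux.
Qed.

(** Product formula for Boolean cumulants: separating the two factors leaves either a single block
    or two blocks cut between [u] and [v]. *)
Lemma beta_merge s1 u v s2 : beta (s1 ++ u * v :: s2) =
  beta (s1 ++ u :: v :: s2) + beta (s1 ++ [:: u]) * beta (v :: s2).
Proof.
rewrite !beta_bcum //; try by case: s1.
case: s1 => [|a s1] /=; last exact: bcum_from_merge.
by ring.
Qed.

Lemma beta1 (u : alg) : beta [:: u] = mu u.
Proof. by rewrite beta_bcum. Qed.

Lemma beta_1l s : s != [::] -> beta (1 :: s) = 0.
Proof.
by case: s => // u s _; rewrite beta_bcum //= mu1 !mul1r subrr.
Qed.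

(** Merging the last 1 into its neighbour changes nothing, while the correction term, having the
    factor [mu 1 = 1], already accounts for the whole cumulant. *)
Lemma beta_1r s : s != [::] -> beta (s ++ [:: 1]) = 0.
Proof.
case: (lastP s) => // {}s u _; rewrite -cats1 -catA /=.
by have := beta_merge s u 1 [::]; rewrite beta1 mu1 !mulr1 -[LHS]add0r => /addIr.
Qed.

Lemma beta_1mid s1 s2 : s1 != [::] -> s2 != [::] ->
  beta (s1 ++ 1 :: s2) = beta (s1 ++ s2).
Proof.
case: (lastP s1) => // {}s1 u _ s20; rewrite -cats1 -!catA /=.
by have := beta_merge s1 u 1 s2; rewrite mulr1 beta_1l // mulr0 addr0.
Qed.

(* The boolean of a pair tells from which of the two subalgebras its second
   component is taken. *)
Definition sided t := forall x, x \in t -> subalg (fun a => p a == x.1) x.2.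
Definition alternate t := sorted (fun x y => x.1 != y.1) t.
Definition centred t := all (fun x => mu x.2 == 0) t.
Notation vals := (map snd).

Lemma sided_cat t1 t2 : sided (t1 ++ t2) <-> sided t1 /\ sided t2.
Proof.
split=> [H|[H1 H2] x]; last by rewrite mem_cat => /orP[/H1|/H2].
by split=> x xt; apply: H; rewrite mem_cat xt ?orbT.
Qed.

Lemma sided_cons x t :
  sided (x :: t) <-> subalg (fun a => p a == x.1) x.2 /\ sided t.
Proof.
split=> [H|[H1 H2] y]; last by rewrite inE => /orP[/eqP->|/H2].
by split=> [|y yt]; apply: H; rewrite inE ?eqxx ?yt ?orbT.
Qed.

Lemma alternate_nth x t j : path (fun x y => x.1 != y.1) x t ->
  (j <= size t)%N -> (nth x (x :: t) j).1 = x.1 (+) odd j.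
Proof.
elim: t x j => [|y t IH] x [|j] //=; rewrite ?addbF // => /andP[xy yt] jt.
rewrite (set_nth_default y) ?IH //.
by case: (x.1) (y.1) (odd j) xy => [] [] [].
Qed.

Lemma mu_centred t : sided t -> alternate t -> centred t -> t != [::] ->
  mu (\prod_(u <- vals t) u) = 0.
Proof.
case: t => // x t sd alt ct _; apply: (mu_free (b := x.1)) => // j.
rewrite size_map => jt; rewrite (nth_map x) //.
rewrite -(alternate_nth alt); last by rewrite -ltnS.
split; first by apply: sd; exact: mem_nth.
by apply/eqP; apply: (allP ct); exact: mem_nth.
Qed.

(** In the moment relation the moment vanishes by freeness and the terms of proper prefixes by
    induction; only [beta (vals t)] is left. *)
Lemma beta_centred t : sided t -> alternate t -> centred t -> t != [::] ->
  beta (vals t) = 0.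
Proof.
have [n] := ubnP (size t); elim: n t => // n IH t lttn sd alt ct t0.
have s0 : vals t != [::] by case: t t0 {lttn sd alt ct}.
have [_ /(_ _ s0)] := betaP; rewrite mu_centred //.
rewrite size_map big_nat_recr ?lt0n ?size_eq0 //=.
rewrite take_oversize ?size_map // drop_oversize ?size_map //.
rewrite big_nil mu1 mulr1 big1_seq ?add0r // => k /andP[_].
rewrite mem_index_iota => /andP[k0 kt]; rewrite -map_take IH ?mul0r //.
- by rewrite (size_takel (ltnW kt)) (leq_trans kt).
- by move=> x /mem_take; exact: sd.
- exact: take_sorted.
- by apply/allP => x /mem_take; move/allP: ct; exact.
- by rewrite -size_eq0 (size_takel (ltnW kt)) -lt0n.
Qed.

Lemma alternate_or_repeat t : alternate t \/
  exists t1 t2 b u v, t = t1 ++ (b, u) :: (b, v) :: t2.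
Proof.
elim: t => [|[b u] t [|[t1 [t2 [c [v [w ->]]]]]]]; first by left.
  case: t => [|[c v] t] alt; first by left.
  have [<-|bc] := eqVneq b c; last by left; rewrite /alternate /= bc.
  by right; exists [::], t, b, u, v.
by right; exists ((b, u) :: t1), t2, c, v, w.
Qed.

(* Adjacent entries from the same side may be multiplied, and in an
   alternating list every entry may be centred at the expense of lists with
   an entry 1; this leaves the centred alternating lists, to which freeness
   applies. *)
Lemma sided_ind (Q : seq (bool * alg) -> Prop) :
  (forall t1 t2 b c u v,
     Q (t1 ++ (b, u) :: t2) -> Q (t1 ++ (b, v) :: t2) ->
     Q (t1 ++ (b, c *: u + v) :: t2)) ->
  (forall t1 t2 b, sided t1 -> sided t2 ->
     (forall t, (size t <= size t1 + size t2)%N -> sided t -> Q t) ->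
     Q (t1 ++ (b, 1) :: t2)) ->
  (forall t1 t2 b u v, sided (t1 ++ (b, u) :: (b, v) :: t2) ->
     (forall t, (size t < (size t1 + size t2).+2)%N -> sided t -> Q t) ->
     Q (t1 ++ (b, u * v) :: t2) -> Q (t1 ++ (b, u) :: (b, v) :: t2)) ->
  (forall t, sided t -> alternate t -> centred t -> Q t) ->
  forall t, sided t -> Q t.
Proof.
move=> Qlin Q1 Qmerge Qcent t; have [n] := ubnP (size t).
elim: n t => // n IH t lttn sd.
have [alt|[t1 [t2 [b [u [v tE]]]]]] := alternate_or_repeat t; last first.
  rewrite tE size_cat /= !addnS in lttn; rewrite {}tE in sd *.
  have /sided_cat[sd1 /sided_cons[/= sdu /sided_cons[/= sdv sd2]]] := sd.
  apply: Qmerge => // [t' ltt|]; first by apply: IH; apply: leq_trans ltt _.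
  apply: IH; first by rewrite size_cat /= addnS.
  by apply/sided_cat; split=> //; apply/sided_cons; split=> //; exact: subalgM.
(* [t1] is the part already centred; the entries of [t2] are centred from left to right. *)
suff H t2 t1 : (size (t1 ++ t2) < n.+1)%N -> sided (t1 ++ t2) ->
    alternate (t1 ++ t2) -> centred t1 -> Q (t1 ++ t2).
  exact: (H t [::]).
elim: t2 t1 {t alt lttn sd} => [|[b u] t2 IHt] t1 ltn sd alt ct1.
  by move: sd alt; rewrite cats0 => sd alt; exact: Qcent.
have /sided_cat[sd1 /sided_cons[/= sdu sd2]] := sd.
rewrite -(subrK (mu u *: 1) u) addrC; apply: Qlin.
  apply: Q1 => // t' let' sd'; apply: IH sd'.
  by move: ltn; rewrite size_cat /= addnS ltnS; apply: leq_trans.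
rewrite -cat_rcons; apply: IHt.
- by move: ltn; rewrite !size_cat size_rcons addSnnS.
- rewrite cat_rcons; apply/sided_cat; split=> //; apply/sided_cons; split=> //=.
  by apply: subalgBZ => //; exact: subalg1.
(* Alternation depends on the sides only: with all second components sent to 0 the two lists
   coincide. *)
- move: alt; rewrite cat_rcons /alternate; set r := fun _ _ => _.
  have mono : {mono (fun x : bool * alg => (x.1, 0 : alg)) : x y / r x y} by [].
  rewrite -(mono_sorted mono) -[in X in _ -> X](mono_sorted mono).
  by rewrite !map_cat.
- rewrite /centred all_rcons; apply/andP; split=> //=.
  by rewrite linearB linearZ /= mu1 mulr1 subrr.
Qed.

(** The common default makes the empty list not mixed. *)
Definition mixed t := head true (map fst t) != last true (map fst t).

(** Dropping an inner 1 or merging entries from one side keeps the end sides. In the product formula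
    both factors have side [b] at the cut, so one of them is again mixed. *)
Lemma beta_mixed t : sided t -> mixed t -> beta (vals t) = 0.
Proof.
move: t; apply: sided_ind.
- move=> t1 t2 b c u v; rewrite /mixed !map_cat /= => H1 H2 mx.
  by rewrite beta_linear H1 // H2 // mulr0 addr0.
- move=> t1 t2 b sd1 sd2 IH; rewrite /mixed !map_cat /=.
  case: t1 t2 sd1 sd2 IH => [|x1 t1] [|x2 t2] sd1 sd2 IH /=.
  + by rewrite eqxx.
  + by rewrite beta_1l.
  + by move=> _; rewrite -cat_cons beta_1r.
  rewrite -cat_cons beta_1mid // last_cat /= => mx.
  have sz : (size ((x1 :: t1) ++ x2 :: t2) <= (size t1).+1 + (size t2).+1)%N.
    by rewrite size_cat.
  have := IH _ sz; rewrite map_cat; apply; first by apply/sided_cat; split.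
  by rewrite /mixed /= !map_cat last_cat.
- move=> t1 t2 b u v sd IH; rewrite !map_cat /= beta_merge => H mx.
  rewrite -[LHS](addrK (beta (vals t1 ++ [:: u]) * beta (v :: vals t2))).
  have mx' : mixed (t1 ++ (b, u * v) :: t2).
    by move: mx; rewrite /mixed !map_cat !last_cat /=; case: (map fst t1).
  rewrite (H mx') sub0r.
  have /sided_cat[sd1 /sided_cons[/= sdu sdv]] := sd.
  have [mx1|nmx1] := boolP (mixed (t1 ++ [:: (b, u)])).
    have sz : (size (t1 ++ [:: (b, u)]) < (size t1 + size t2).+2)%N.
      by rewrite size_cat /= addn1 !ltnS leq_addr.
    have sd' : sided (t1 ++ [:: (b, u)]).
      by apply/sided_cat; split=> //; apply/sided_cons.
    by have := IH _ sz sd' mx1; rewrite map_cat /= => ->; rewrite mul0r oppr0.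
  have sz : (size ((b, v) :: t2) < (size t1 + size t2).+2)%N.
    by rewrite !ltnS leq_addl.
  suff mx2 : mixed ((b, v) :: t2) by rewrite (IH _ sz sdv mx2) mulr0 oppr0.
  move: mx nmx1; rewrite /mixed !map_cat !last_cat /= negbK.
  have h l : head true (map fst t1 ++ b :: l) = head b (map fst t1) by case: (t1).
  by rewrite !h => + /eqP hb; rewrite hb.
- move=> t sd alt ct mx; apply: beta_centred => //.
  by apply: contraTneq mx => ->; rewrite /mixed eqxx.
Qed.

(** If [r] is a single entry, its scalar part contributes a cumulant starting with 1 and its centred
    part a centred alternating list. A longer [r] is shortened by the product formula for its first
    two entries. *)
Lemma beta_prefix_centred r t b : r != [::] -> sided r -> t != [::] ->
  all (pred1 b) (map fst r) -> head b (map fst t) != b ->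
  sided t -> alternate t -> centred t -> beta (vals r ++ vals t) = 0.
Proof.
move=> r0 sdr t0 rb tb sdt alt ct.
have [n] := ubnP (size r); elim: n r r0 sdr rb => // n IH [|[c x] r] // _.
move=> /sided_cons[/= sdx sdr] /andP[/= /eqP cb rb] ltrn; subst c.
case: r sdr rb ltrn => [|[c y] r] /= sdr rb ltrn.
  rewrite -(subrK (mu x *: 1) x) addrC.
  have /= -> := beta_linear [::] (vals t) (mu x) 1 (x - mu x *: 1).
  rewrite beta_1l ?mulr0 ?add0r; last by case: (t) t0.
  apply: (beta_centred (t := (b, x - mu x *: 1) :: t)) => //.
  - apply/sided_cons; split=> //=; apply: subalgBZ => //; exact: subalg1.
  - by case: (t) t0 alt tb => //= z t' _; rewrite /alternate /= eq_sym => -> ->.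
  - by rewrite /centred /= linearB linearZ /= mu1 mulr1 subrr eqxx.
have /sided_cons[/= sdy sdr'] := sdr; case/andP: (rb) => /= /eqP cb rb'; subst c.
have IH1 : beta (x * y :: vals r ++ vals t) = 0.
  have sd : sided ((b, x * y) :: r).
    by apply/sided_cons; split; [exact: subalgM|exact: sdr'].
  by apply: (IH ((b, x * y) :: r) isT sd _ ltrn); rewrite /= eqxx.
have IH2 : beta (y :: vals r ++ vals t) = 0.
  by apply: (IH ((b, y) :: r) isT sdr _ ltrn); rewrite /= eqxx.
have /= := beta_merge [::] x y (vals r ++ vals t).
by rewrite IH1 IH2 mulr0 addr0 => <-.
Qed.

(** All cuts are summed, so that the formula is stable under the reductions of [sided_ind]; left
    parts ending on side [b] have mixed ends and contribute 0. The default [b] of [head] excludes an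
    empty [t]. *)
Lemma beta_prefix r b : r != [::] -> sided r -> all (pred1 b) (map fst r) ->
  forall t, sided t -> head b (map fst t) != b ->
  beta (vals r ++ vals t) =
  conv (reduced beta) (reduced (fun s => beta (vals r ++ s))) (vals t).
Proof.
move=> r0 sdr rb; set q := reduced (fun s => beta (vals r ++ s)).
have vr0 : vals r != [::] by case: (r) r0.
apply: sided_ind.
- move=> t1 t2 d c u v; rewrite !map_cat /= => H1 H2 hd.
  rewrite catA beta_linear -!catA (H1 hd) (H2 hd) !conv_mid.
  rewrite mulrDr addrACA -convZr -convDr -convZl -convDl; congr (_ + _).
    apply: eq_conv => // w; rewrite /q !reducedE /= !catA.
    exact/esym/beta_linear.
  apply: eq_conv => // w; rewrite /q !reducedE; exact/esym/beta_linear.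
- move=> t1 t2 d sd1 sd2 IH; rewrite !map_cat /= => hd.
  have [t10|t10] := eqVneq t1 [::].
    (* Among the cumulants starting with 1 only that of the list with the single entry 1 survives,
       so the left factor acts as the unit. *)
    rewrite t10 /= conv_cons mul0r add0r (eq_conv (f' := conv_one) (g' := q)) //.
      rewrite conv1l /q /reduced; case: (vals t2) => [|x s2] /=.
        by rewrite beta_1r.
      by rewrite beta_1mid.
    by case=> [|x w]; rewrite /reduced /= ?beta1 ?mu1 // beta_1l.
  have s10 : vals t1 != [::] by case: (t1) t10.
  have [t20|t20] := eqVneq t2 [::].
    rewrite t20 /= conv_mid conv_nil mulr0 addr0 catA beta_1r; last first.
      by case: (r) r0.
    rewrite conv0r // => w; rewrite /q reducedE catA beta_1r //.
    by case: (r) r0.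
  have s20 : vals t2 != [::] by case: (t2) t20.
  have IH1 : beta (vals r ++ vals t1 ++ vals t2) =
      conv (reduced beta) q (vals t1 ++ vals t2).
    have sz : (size (t1 ++ t2) <= size t1 + size t2)%N by rewrite size_cat.
    have sd : sided (t1 ++ t2) by apply/sided_cat; split.
    have := IH _ sz sd; rewrite !map_cat; apply.
    by move: hd; case: (t1) t10.
  rewrite catA beta_1mid //; last by case: (r) r0.
  rewrite -catA IH1.
  (* Dropping the 1 identifies the cuts before and after it. The cut after it has a left factor
     ending in 1, which is 0; this matches the correction term of [conv_cat]. *)
  have /(canRL (addrK _)) -> := conv_cat (reduced beta) q (vals t1) (vals t2).
  rewrite conv_mid -addrA; congr (_ + _).
    apply: eq_conv => // w; rewrite /q reducedE catA beta_1mid //.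
      by case: (vals t2) s20 => // x s _; rewrite reducedE catA.
    by case: (r) r0.
  rewrite -mulNr -(conv1l q (vals t2)) -convZl -convDl.
  apply: eq_conv => // -[|x w]; rewrite /conv_one /= reducedE.
    by rewrite cats0 mulr1 subrr beta_1r.
  by rewrite mulr0 addr0 reducedE beta_1mid.
- move=> t1 t2 d u v sd IH; rewrite !map_cat /= => H hd.
  have /sided_cat[sd1 /sided_cons[/= sdu sdv]] := sd.
  have hd1 l : head b (map fst t1 ++ d :: l) != b by move: hd; case: (map fst t1).
  have IH1 : beta (vals r ++ vals t1 ++ [:: u]) =
      conv (reduced beta) q (vals t1 ++ [:: u]).
    have sz : (size (t1 ++ [:: (d, u)]) < (size t1 + size t2).+2)%N.
      by rewrite size_cat /= addn1 !ltnS leq_addr.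
    have sd' : sided (t1 ++ [:: (d, u)]).
      by apply/sided_cat; split=> //; apply/sided_cons.
    by have := IH _ sz sd'; rewrite !map_cat; apply; exact: hd1.
  (* This concerns the cut between [u] and [v]. If [d != b], the tail starting with [v] falls under
     the induction hypothesis; if [d = b], the left factor has mixed ends and vanishes. *)
  have IH2 : reduced beta (vals t1 ++ [:: u]) *
      conv (reduced beta) q (v :: vals t2) =
      reduced beta (vals t1 ++ [:: u]) * q (v :: vals t2).
    have [db|db] := eqVneq d b; last first.
      have sz : (size ((d, v) :: t2) < (size t1 + size t2).+2)%N.
        by rewrite !ltnS leq_addl.
      by have /= <- := IH _ sz sdv db.
    suff mx : mixed (t1 ++ [:: (d, u)]).
      have := beta_mixed _ mx; rewrite reducedE map_cat => ->.
        by rewrite !mul0r.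
      by apply/sided_cat; split=> //; apply/sided_cons.
    rewrite /mixed map_cat last_cat /= db.
    by move: (hd1 [::]); rewrite db; case: (map fst t1) => //=; rewrite eqxx.
  have ruv w : q (w ++ u * v :: vals t2) =
      q (w ++ u :: v :: vals t2) + beta (v :: vals t2) * q (w ++ [:: u]).
    by rewrite /q !reducedE catA beta_merge mulrC -!catA.
  have luv w : reduced beta (vals t1 ++ u * v :: w) =
      reduced beta (vals t1 ++ u :: v :: w) +
      reduced beta (vals t1 ++ [:: u]) * reduced beta (v :: w).
    by rewrite !reducedE beta_merge.
  have := H (hd1 _); rewrite catA beta_merge -!catA IH1 => /(canRL (addrK _)) ->.
  rewrite !conv_mid conv_nil mulr0 addr0.
  rewrite (eq_conv (frefl _) ruv) (eq_conv luv (frefl _)).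
  rewrite convDr convZr convDl convZl conv_cons.
  move: IH2; rewrite conv_cons mul0r add0r => ->.
  have aux (A C D P x : K) : A + x * C + (D + P) - C * x = A + (P + D) by ring.
  exact: aux.
- move=> t sd alt ct hd.
  have t0 : t != [::] by apply: contraNneq hd => ->.
  rewrite (beta_prefix_centred r0 sdr t0 rb) //.
  rewrite /conv big1 // => j _; rewrite -map_take.
  have [->|tj] := eqVneq (take j t) [::]; first by rewrite mul0r.
  rewrite /reduced -[nilp _]/(size _ == 0)%N size_map size_eq0 (negbTE tj).
  rewrite beta_centred ?mul0r //; first by move=> x /mem_take; exact: sd.
    exact: take_sorted.
  by apply/allP => x /mem_take; move/allP: ct; exact.
Qed.

End Freeness.

(** * Delta and block cumulants as series *)

Section Words.
Variables (K : comNzRingType) (L : choiceType).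
Notation alg := {malg K[{fmonom L}]}.
Variables (p : pred L) (mu : {scalar alg}) (beta : seq alg -> K).
Hypothesis mu1 : mu 1 = 1.
Hypothesis mu_free : free_sides p mu.
Hypothesis betaP : boolean_cumulants mu beta.

Let beta_merge := beta_merge mu1 betaP.

Local Notation letters := (map (@letter K L)).
Local Notation words := (map (@word K L)).

Lemma wordM (u v : seq L) : word K u * word K v = word K (u ++ v).
Proof.
by rewrite /word malgM_def fgmulUU mulr1; congr mkmalgU; exact/val_inj/fmM.
Qed.

(** The series B_X or B_Y: unlike [delta_cumulant], it is 0 at the empty word. *)
Definition delta_word (q : pred L) (w : seq L) : K :=
  if ends_in q w then beta (letters w) else 0.

Definition block_word (q : pred L) (w : seq L) : K :=
  if w == [::] then 1
  else if ends_in q w then beta (words (runs q w)) else 0.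

Lemma runs_cons (q : pred L) a w :
  exists u rs, runs q (a :: w) = (a :: u) :: rs.
Proof.
rewrite /=; case: (runs q w) => [|[|b u] rs]; try by exists [::]; eexists.
by case: ifP => _; do 2 eexists.
Qed.

Section Expansion.
Variable q : pred L.
Hypothesis beta_letters_mixed : forall a w,
  q a != q (last a w) -> beta (letters (a :: w)) = 0.

Lemma delta_word_cons a w : q a ->
  delta_word q (a :: w) = beta (letters (a :: w)).
Proof.
move=> qa; rewrite /delta_word [ends_in _ _]/= qa.
by case: ifP => //= qw; rewrite [RHS]beta_letters_mixed // qa qw.
Qed.

Lemma ends_in_cat u a v :
  ends_in q (u ++ a :: v) = q (head a u) && q (last a v).
Proof. by case: u => [|b u] //=; rewrite last_cat. Qed.

(** The part [u] is already split into letters, the rest is still in blocks. Splitting [a] off its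
    block yields, by [beta_merge], the term of the cut after [a]. If [a] is a whole block followed
    by another one, nothing is split, and that cut contributes 0. *)
Lemma beta_runs u a w : q (head a u) -> q (last a w) ->
  beta (letters u ++ words (runs q (a :: w))) =
  conv (fun v => delta_word q (u ++ a :: v)) (block_word q) w.
Proof.
elim: w u a => [|b w IH] u a qu qw.
  rewrite conv_nil mulr1 /delta_word ends_in_cat qu qw map_cat.
  by [].
have hE : head b (rcons u a) = head a u by case: (u).
have := IH (rcons u a) b; rewrite hE => /(_ qu qw).
rewrite conv_cons map_rcons cat_rcons.
rewrite (eq_conv (f' := fun v => delta_word q (u ++ [:: a, b & v]))
  (g' := block_word q)) //; last by move=> v; rewrite cat_rcons.
move=> <-.
have [v [rs rE]] := runs_cons q b w.
have -> : words (runs q (b :: w)) = words ((b :: v) :: rs) by rewrite rE.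
have -> : runs q (a :: b :: w) =
    if q a == q b then [:: a, b & v] :: rs else [:: [:: a], b :: v & rs].
  by move: rE; rewrite /= => ->.
have dE : delta_word q (u ++ [:: a]) =
    (q a)%:R * beta (letters u ++ [:: letter K a]).
  rewrite /delta_word ends_in_cat qu /= map_cat.
  by case: (q a); rewrite ?mul1r ?mul0r.
have bE : block_word q (b :: w) = (q b)%:R * beta (words ((b :: v) :: rs)).
  rewrite /block_word -rE [ends_in _ _]/= qw andbT.
  by case: (q b); rewrite ?mul1r ?mul0r.
have d0 : ~~ q a -> beta (letters u ++ [:: letter K a]) = 0.
  case: (u) qu => [|c u'] /= qc nqa; first by rewrite qc in nqa.
  have := @beta_letters_mixed c (rcons u' a).
  by rewrite last_rcons qc (negbTE nqa) /= map_rcons -cats1; apply.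
rewrite {}dE {}bE.
case: eqP => [qab|qab] /=.
  rewrite -(cat1s a (b :: v)) -wordM beta_merge addrC; congr (_ + _).
  move: d0; rewrite qab; case: (q b) => [_|/(_ isT) ->]; first by rewrite !mul1r.
  by rewrite !mul0r.
rewrite -[LHS]add0r; congr (_ + _).
by move: qab; case: (q a) (q b) => [] []; rewrite ?mul0r ?mulr0.
Qed.

Lemma block_wordE w :
  block_word q w = conv_one w + conv (delta_word q) (block_word q) w.
Proof.
case: w => [|a w]; first by rewrite conv_nil mul0r addr0.
rewrite conv_cons mul0r !add0r {1}/block_word.
have [/andP[qa qw]|qaw] := boolP (ends_in q (a :: w)).
  exact: (beta_runs (u := [::])).
(* If an end of the word lies outside [q], the factor containing this end vanishes at every cut. *)
rewrite /conv big1 //= => j _; rewrite /delta_word /block_word /=.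
case: ifP => [/andP[qa qj]|]; last by rewrite mul0r.
move: qaw; rewrite -{1}(cat_take_drop j w) /= qa last_cat /=.
case: (drop j w) => [|b v] /=; first by rewrite qj.
by move=> /negbTE ->; rewrite andbF mulr0.
Qed.

Lemma block_wordEr w :
  block_word q w = conv_one w + conv (block_word q) (delta_word q) w.
Proof. by move: w; apply: conv_inv_sym => //; exact: block_wordE. Qed.

End Expansion.

Lemma beta_letters_mixed a w :
  p a != p (last a w) -> beta (letters (a :: w)) = 0.
Proof.
move=> mx; pose t := [seq (p b, letter K b) | b <- a :: w].
have -> : letters (a :: w) = map snd t by rewrite -map_comp.
apply: (beta_mixed mu1 mu_free betaP (t := t)).
  by move=> _ /mapP[b _ ->] /=; apply: subalg_letter.
have tp : map fst t = map p (a :: w) by rewrite -map_comp.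
by rewrite /mixed tp /= last_map.
Qed.

Section Prefix.
Variable q : pred L.
Hypothesis qE : q =1 predC p.

Lemma beta_letters_mixedC a w :
  q a != q (last a w) -> beta (letters (a :: w)) = 0.
Proof. by rewrite !qE (inj_eq negb_inj); apply: beta_letters_mixed. Qed.

Lemma beta_letters_prefix v a w : v != [::] -> all p v -> q a ->
  beta (letters (v ++ a :: w)) = conv (delta_word q)
    (reduced (fun u => beta (letters (v ++ u)))) (a :: w).
Proof.
move=> v0 pv qa; pose tag := [seq (p b, letter K b) | b <- _].
have tagE u : letters u = map snd (tag u) by rewrite -map_comp.
have tag_sided u : sided p (tag u).
  by move=> _ /mapP[b _ ->] /=; apply: subalg_letter.
have tag_fst u : map fst (tag u) = map p u by rewrite -map_comp.
rewrite map_cat !tagE (beta_prefix (b := true) mu1 mu_free betaP) //.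
- rewrite -!tagE conv_map !conv_cons; congr (_ + _); first by rewrite !mul0r.
  apply: eq_conv => u; first by rewrite (delta_word_cons beta_letters_mixedC) ?qa.
  by rewrite /reduced map_cat; case: u.
- by case: (v) v0.
- by rewrite tag_fst all_map; apply: sub_all pv => b /= ->.
- by rewrite tag_fst /=; rewrite qE /= in qa; case: (p a) qa.
Qed.

(* Geometric series: solving f = g + d f for f gives f = b g, b = 1 + b d. *)
Lemma beta_letters_gap v w : v != [::] -> all p v ->
  beta (letters (v ++ w)) = conv_one w * beta (letters v) +
    conv (block_word q) (fun u => if u is a :: _
      then (p a)%:R * beta (letters (v ++ u)) else 0) w.
Proof.
move=> v0 pv; set g := fun u : seq L => _.
set f := reduced (fun u => beta (letters (v ++ u))).
(* On words starting in [p] the convolution vanishes and [g] is [f]; on words starting in [q], [g]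
   is 0 and [beta_letters_prefix] applies. *)
have fE u : f u = g u + conv (delta_word q) f u.
  case: u => [|a u]; first by rewrite conv_nil mulr0 addr0.
  have -> : f (a :: u) = beta (letters (v ++ a :: u)) by [].
  rewrite /g; have [pa|pa] := boolP (p a).
    rewrite conv_cons mul0r add0r conv0l ?addr0 ?mul1r // => u'.
    by rewrite /delta_word /= qE /= pa.
  by rewrite mul0r add0r beta_letters_prefix // qE.
have -> : beta (letters (v ++ w)) = conv_one w * beta (letters v) + f w.
  by case: w => [|a w]; rewrite ?mul0r ?add0r // cats0 mul1r addr0.
congr (_ + _); rewrite -[LHS]conv1l.
have bE u : block_word q u = conv_one u + conv (block_word q) (delta_word q) u.
  exact/block_wordEr/beta_letters_mixedC.
have : conv (block_word q) f w = conv (block_word q) g w +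
    conv (conv (block_word q) (delta_word q)) f w.
  by rewrite convA -convDr; exact: eq_conv.
rewrite {1}(eq_conv bE (frefl f)) convDl.
by move=> /addIr.
Qed.

End Prefix.
End Words.

(** * Evaluation of the tensor expressions *)

Section LinearExtensionTheory.
Variables (K : comNzRingType) (B : choiceType) (V : lmodType K).

Lemma eq_linext_in (f g : B -> V) (P : {malg K[B]}) :
  {in msupp P, f =1 g} -> linext f P = linext g P.
Proof. by move=> fg; apply: eq_big_seq => b bP; rewrite fg. Qed.

Lemma linext_comp (B' : choiceType) (f : B -> V) (g : B' -> {malg K[B]}) P :
  linext f (linext g P) = linext (fun b => linext f (g b)) P.
Proof.
rewrite [in LHS]/linext -[LHS]/(linext f (\sum_(b <- msupp P) P@_b *: g b)).
by rewrite linear_sum; apply: eq_bigr => b _; rewrite linearZ.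
Qed.

Lemma linextD (f g : B -> V) (P : {malg K[B]}) :
  linext (fun b => f b + g b) P = linext f P + linext g P.
Proof. by rewrite -big_split; apply: eq_bigr => b _; rewrite scalerDr. Qed.

Lemma linext_sum (I : Type) (r : seq I) (Q : pred I) (f : I -> B -> V)
    (P : {malg K[B]}) :
  linext (fun b => \sum_(i <- r | Q i) f i b) P =
  \sum_(i <- r | Q i) linext (f i) P.
Proof. by rewrite exchange_big; apply: eq_bigr => b _; rewrite scaler_sumr. Qed.

Lemma linextZ (c : K) (f : B -> V) (P : {malg K[B]}) :
  linext (fun b => c *: f b) P = c *: linext f P.
Proof.
by rewrite scaler_sumr; apply: eq_bigr => b _; rewrite !scalerA mulrC.
Qed.

End LinearExtensionTheory.

Section WordFunctionals.
Variables (K : comNzRingType) (L : choiceType).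
Implicit Types (f g : seq L -> K) (a : L) (w : seq L).
Notation alg := {malg K[{fmonom L}]}.

Definition wordext f : alg -> K :=
  linext (V := K^o) (fun w : {fmonom L} => f w).

Lemma epsE (P : alg) : eps P = wordext conv_one P.
Proof.
rewrite {1}(monalgE P) /eps raddf_sum; apply: eq_bigr => w _ /=.
rewrite mcoeffU -mulr_natr -[RHS]/(P@_w * (nilp w)%:R).
suff -> : (w == FMonom [::]) = nilp w by [].
by apply/eqP/nilP => [->|w0] //; apply: val_inj.
Qed.

Definition letter_ind a w : K := (w == [:: a])%:R.

Lemma conv_letter_cons a f b w :
  conv (letter_ind a) f (b :: w) = (b == a)%:R * f w.
Proof.
rewrite conv_cons mul0r add0r /letter_ind.
rewrite (eq_conv (f' := fun u => (b == a)%:R * conv_one u) (g' := f)) //.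
  by rewrite convZl conv1l.
by case=> [|c u]; rewrite eqseq_cons ?andbT ?mulr1 // andbF mulr0.
Qed.

Lemma conv_letter_nil a f : conv (letter_ind a) f [::] = 0.
Proof. by rewrite conv_nil mul0r. Qed.

Lemma eq_conv_suffix f g g' w :
  (forall u, (size u <= size w)%N -> g u = g' u) ->
  conv f g w = conv f g' w.
Proof.
by move=> gg; apply: eq_bigr => j _; rewrite gg // size_drop leq_subr.
Qed.

Lemma eq_conv_letter a g g' w :
  (forall u, (size u < size w)%N -> g u = g' u) ->
  conv (letter_ind a) g w = conv (letter_ind a) g' w.
Proof.
case: w => [|b w] gg; first by rewrite !conv_letter_nil.
by rewrite !conv_letter_cons gg.
Qed.

(** Cutting out an occurrence of [a], as the free difference quotient does, is dual to the Cauchy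
    product with the series of the letter between the factors. *)
Lemma conv_cutE a f g w : conv f (conv (letter_ind a) g) w =
  \sum_(j < size w | tnth (in_tuple w) j == a) f (take j w) * g (drop j.+1 w).
Proof.
rewrite /conv big_ord_recr /= drop_size -/(conv _ _ _) conv_letter_nil.
rewrite mulr0 addr0 [RHS]big_mkcond; apply: eq_bigr => j _ /=.
rewrite -/(conv _ _ _) (drop_nth a) // conv_letter_cons.
rewrite (tnth_nth a) /=.
by case: eqP => _; rewrite ?mul1r // mul0r mulr0.
Qed.

(** The functionals are indexed by [nat], so that legs can be shifted when the tensor power
    changes. *)
Definition tensext k (F : nat -> seq L -> K) :
    {malg K[k.-tuple {fmonom L}]} -> K :=
  linext (V := K^o)
    (fun t : k.-tuple {fmonom L} => \prod_(j < k) F j (tnth t j)).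

Lemma tensext_fdq a k (F : nat -> seq L -> K)
    (T : {malg K[k.+1.-tuple {fmonom L}]}) :
  tensext F (fdq_left a T) =
  tensext (fun j => if j is j'.+1 then F j'.+2
    else conv (F 0) (conv (letter_ind a) (F 1))) T.
Proof.
rewrite /tensext linext_comp; apply: (eq_linext_in (V := K^o)) => t _.
rewrite [in RHS]big_ord_recl /= conv_cutE mulr_suml linear_sum.
apply: eq_bigr => j _; rewrite /= linextU 2!big_ord_recl mulrA.
congr (_ * _ * _); apply: eq_bigr => i _; congr (F _ _).
by rewrite !(tnth_nth (FMonom [::])) /= nth_behead.
Qed.

(** The Cauchy product f a_1 F_0 a_2 F_1 ..., bracketed to the right. *)
Fixpoint chain (f : seq L -> K) (F : nat -> seq L -> K) (s : seq L) :=
  if s is a :: s' then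
    conv f (conv (letter_ind a) (chain (F 0) (fun j => F j.+1) s'))
  else f.

Lemma chain_conv f g F s : chain (conv f g) F s =1 conv f (chain g F s).
Proof. by case: s => // a s w; rewrite /= convA. Qed.

Lemma tensext_iter_fdq f F s P :
  tensext (fun j => if j is j'.+1 then F j' else f) (iter_fdq s P) =
  wordext (chain f F s) P.
Proof.
elim: s f F => [|a s IH] f F /=.
  rewrite /tensext linext_comp; apply: (eq_linext_in (V := K^o)) => w _.
  by rewrite linextU big_ord_recl big_ord0 mulr1.
(* The outermost derivative glues the first two functionals around [a]; [chain_conv] restores the
   bracketing. *)
transitivity (wordext (chain (conv f (conv (letter_ind a) (F 0)))
  (fun j => F j.+1) s) P); last first.
  apply: (eq_linext_in (V := K^o)) => w _; rewrite chain_conv.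
  by apply: eq_conv => // u; rewrite chain_conv.
rewrite -IH tensext_fdq; apply: (eq_linext_in (V := K^o)) => t _.
by apply: eq_bigr => -[[|j] ?].
Qed.

End WordFunctionals.

Section DeltaExpansion.
Variables (K : comNzRingType) (L : choiceType) (p : pred L).
Notation alg := {malg K[{fmonom L}]}.
Variable beta : seq alg -> K.
Implicit Types (P : alg) (w : seq L).

Lemma eps_word w : eps (word K w) = conv_one w.
Proof. by rewrite epsE /wordext linextU. Qed.

Lemma block_cumulantE P :
  block_cumulant p beta P = wordext (block_word beta p) P.
Proof. by []. Qed.

Lemma block_cumulant_word w :
  block_cumulant p beta (word K w) = block_word beta p w.
Proof. by rewrite block_cumulantE /wordext linextU. Qed.

Lemma delta_cumulantE P : delta_cumulant p beta P =
  wordext (fun w => conv_one w + delta_word beta p w) P.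
Proof.
apply: (eq_linext_in (V := K^o)) => -[[|a w]] _; first by rewrite addr0.
by rewrite add0r.
Qed.

Lemma delta_cumulant_word w : w != [::] ->
  delta_cumulant p beta (word K w) = delta_word beta p w.
Proof.
by rewrite delta_cumulantE /wordext linextU; case: w => //= a w _; rewrite add0r.
Qed.

Lemma tens2E (f g : alg -> K) (u v : {fmonom L}) :
  tens2 f g << [tuple u; v] >> = f << u >> * g << v >>.
Proof.
by rewrite /tens2 /tens_fun linextU !big_ord_recl big_ord0 mulr1.
Qed.

(** Restricting the cuts to those after a letter of [p] loses nothing: at the other cuts the left
    part is empty or ends outside [p], and [delta_word] is 0 there. *)
Lemma tens2_left_delta P :
  tens2 (delta_cumulant p beta) (block_cumulant p beta) (left_delta p P) =
  wordext (conv (delta_word beta p) (block_word beta p)) P.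
Proof.
rewrite /tens2 /tens_fun /left_delta linext_comp.
apply: (eq_linext_in (V := K^o)) => w _; rewrite linear_sum.
transitivity (\sum_(j < size w | p (tnth (in_tuple w) j))
    delta_cumulant p beta (word K (take j.+1 w)) *
    block_cumulant p beta (word K (drop j.+1 w))).
  by apply: eq_bigr => j _; exact: tens2E.
rewrite /conv big_ord_recl take0 mul0r add0r big_mkcond.
apply: eq_bigr => j _; rewrite block_cumulant_word.
rewrite delta_cumulant_word; last first.
  by rewrite -size_eq0 size_takel // -lt0n.
have wjE := esym (tnth_nth (tnth (in_tuple w) j) (in_tuple w) j).
rewrite lift0 (take_nth (tnth (in_tuple w) j)) // [nth _ _ _]wjE.
case: ifP => // pj; rewrite /delta_word; case: (take j w) => [|a u] /=.
  by rewrite pj mul0r.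
by rewrite last_rcons pj andbF mul0r.
Qed.

Lemma tens2_right_delta P :
  tens2 (block_cumulant p beta) (delta_cumulant p beta) (right_delta p P) =
  wordext (conv (block_word beta p) (delta_word beta p)) P.
Proof.
rewrite /tens2 /tens_fun /right_delta linext_comp.
apply: (eq_linext_in (V := K^o)) => w _; rewrite linear_sum.
transitivity (\sum_(j < size w | p (tnth (in_tuple w) j))
    block_cumulant p beta (word K (take j w)) *
    delta_cumulant p beta (word K (drop j w))).
  by apply: eq_bigr => j _; exact: tens2E.
rewrite /conv big_ord_recr /= drop_size mulr0 addr0 big_mkcond.
apply: eq_bigr => j _; rewrite block_cumulant_word.
have wjE := esym (tnth_nth (tnth (in_tuple w) j) (in_tuple w) j).
rewrite (drop_nth (tnth (in_tuple w) j)) // delta_cumulant_word // [nth _ _ _]wjE.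
by case: ifP => // pj; rewrite /delta_word /= pj mulr0.
Qed.

End DeltaExpansion.

Section TupleSums.
Variables (V : nmodType) (T : finType) (F : seq T -> V).

Lemma big_tuple_nil : \sum_(i : 0.-tuple T) F i = F [::].
Proof. by rewrite (big_pred1 [tuple]) // => i; apply/esym/eqP; exact: tuple0. Qed.

Lemma big_tuple_cons k :
  \sum_(i : k.+1.-tuple T) F i = \sum_(a : T) \sum_(i : k.-tuple T) F (a :: i).
Proof.
rewrite pair_big (reindex (fun q : T * k.-tuple T => [tuple of q.1 :: q.2])) //.
exists (fun i : k.+1.-tuple T => (thead i, [tuple of behead i])) => [[a i]|i] _.
  by congr pair; apply: val_inj.
by rewrite [RHS]tuple_eta; apply: val_inj.
Qed.

End TupleSums.

(** * The two alphabets *)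

Section TwoAlphabets.
Variables (K : comNzRingType) (m n : nat).
Notation L := ('I_m + 'I_n)%type.
Notation alg := {malg K[{fmonom L}]}.
Variables (mu : {scalar alg}) (beta : seq alg -> K).
Hypothesis mu1 : mu 1 = 1.
Hypothesis mu_free : free_sides isX mu.
Hypothesis betaP : boolean_cumulants mu beta.
Implicit Types (P : alg) (w : seq L).

Local Notation letters := (map (@letter K L)).
Local Notation blockY := (block_word beta isY).
Local Notation lX := (@inl 'I_m 'I_n).
Local Notation lXs := (map lX).

Lemma isYE : isY =1 predC (isX : pred L).
Proof. by case. Qed.

(** The series bY a_1 bY a_2 ... bY a_k, with nothing after the last chosen letter. *)
Fixpoint gaps (s : seq L) : seq L -> K :=
  if s is a :: s' then conv blockY (conv (letter_ind K a) (gaps s'))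
  else conv_one.

Lemma gaps_small s w : (size w < size s)%N -> gaps s w = 0.
Proof.
elim: s w => //= a s IH w ltw.
rewrite (@eq_conv_suffix _ _ _ _ (fun=> 0)) ?conv0r // => u leu.
rewrite (@eq_conv_letter _ _ _ _ (fun=> 0)) ?conv0r // => v ltv.
by apply: IH; apply: leq_trans ltv _; apply: leq_trans leu _.
Qed.

Lemma chain_gaps (F : nat -> seq L -> K) s :
  (forall j, (j < size s)%N -> F j =1 blockY) -> F (size s) =1 conv_one ->
  chain (F 0) (fun j => F j.+1) s =1 gaps s.
Proof.
elim: s F => [|a s IH] F FY F1 w //=.
apply: eq_conv => [|u]; first exact: FY.
apply: eq_conv => // v; apply: (IH (fun j => F j.+1)) => [j js|] //.
exact: FY.
Qed.

Lemma tens_ends_fdq a s P :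
  tens_ends eps (block_cumulant isY beta) (iter_fdq (a :: s) P) =
  wordext (conv (letter_ind K a) (gaps s)) P.
Proof.
(* The legs after the first are counted from 0, so the last one has index [size s]. *)
pose F j := if j == size s then conv_one else blockY.
transitivity (tensext (fun j => if j is j'.+1 then F j' else conv_one)
    (iter_fdq (a :: s) P)).
  apply: (eq_linext_in (V := K^o)) => t _; apply: eq_bigr => j _.
  case: (tnth t j) => w; case: j => [[|j] jk] /=; first exact: eps_word.
  rewrite /F eqSS; case: ifP => _; first exact: eps_word.
  exact: block_cumulant_word.
rewrite tensext_iter_fdq; apply: (eq_linext_in (V := K^o)) => w _ /=.
rewrite conv1l; apply: eq_conv => // u; apply: chain_gaps => [j js|].
  by rewrite /F ltn_eqF.
by rewrite /F eqxx.
Qed.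

(** Iteration of [beta_letters_gap]: each newly chosen letter of X is appended to [v], and the
    remaining word gets shorter. Gaps may themselves contain letters of X. *)
Lemma beta_letters_gaps N v w : v != [::] -> all isX v -> (size w <= N)%N ->
  beta (letters (v ++ w)) = \sum_(k < N.+1) \sum_(i : k.-tuple 'I_m)
    beta (letters (v ++ lXs i)) * gaps (lXs i) w.
Proof.
elim: N v w => [|N IH] v w v0 pv wN; rewrite big_ord_recl;
  pose term i := beta (letters (v ++ lXs i)) * gaps (lXs i) w.
  rewrite big_ord0 addr0 (big_tuple_nil term) /term {term}.
  by case: w wN => //= _; rewrite cats0 mulr1.
rewrite (big_tuple_nil term) /term /= cats0.
rewrite (beta_letters_gap mu1 mu_free betaP isYE) // mulrC; congr (_ + _).
(* The test on the first letter becomes a sum over X in which at most one summand is nonzero. *)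
transitivity (conv blockY (fun u => \sum_(a : 'I_m)
   conv (letter_ind K (lX a))
     (fun u' => beta (letters (rcons v (lX a) ++ u'))) u) w).
  apply: eq_conv => // -[|[b|b] u].
  - by rewrite big1 // => a _; rewrite conv_letter_nil.
  - rewrite (bigD1 b) //= conv_letter_cons eqxx cat_rcons big1 ?addr0 // => a ab.
    by rewrite conv_letter_cons eq_sym (inj_eq inl_inj) (negbTE ab) mul0r.
  - by rewrite mul0r big1 // => a _; rewrite conv_letter_cons mul0r.
rewrite conv_sumr.
transitivity (\sum_(a : 'I_m) \sum_(k < N.+1) \sum_(i : k.-tuple 'I_m)
   beta (letters (v ++ lXs (a :: i))) * gaps (lXs (a :: i)) w).
  apply: eq_bigr => a _.
  transitivity (conv blockY (conv (letter_ind K (lX a))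
    (fun u' => \sum_(k < N.+1) \sum_(i : k.-tuple 'I_m)
       beta (letters (rcons v (lX a) ++ lXs i)) * gaps (lXs i) u')) w).
    apply: eq_conv_suffix => u uw; apply: eq_conv_letter => u' uu'.
    apply: IH; first by case: (v).
      by rewrite all_rcons /= pv.
    by rewrite -ltnS (leq_trans uu') // (leq_trans uw).
  rewrite -convA conv_sumr; apply: eq_bigr => k _.
  rewrite conv_sumr; apply: eq_bigr => i _.
  by rewrite convZr convA cat_rcons.
rewrite exchange_big; apply: eq_bigr => k _.
exact/esym/(big_tuple_cons term).
Qed.


(** The first letter of [w] has to be the first chosen one, so [k] counts only the further ones. *)
Lemma delta_word_gaps N w : (size w <= N)%N ->
  delta_word beta isX w = \sum_(k < N) \sum_(i : k.-tuple 'I_m) \sum_(a : 'I_m)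
    beta (letters (lXs (a :: i))) * conv (letter_ind K (lX a)) (gaps (lXs i)) w.
Proof.
case: w => [|b w] wN.
  rewrite big1 // => k _; rewrite big1 // => i _; rewrite big1 // => a _.
  by rewrite conv_letter_nil mulr0.
case: N wN => // N; case: b => b wN; last first.
  rewrite big1 // => k _; rewrite big1 // => i _; rewrite big1 // => a _.
  by rewrite conv_letter_cons mul0r mulr0.
rewrite (delta_word_cons (beta_letters_mixed mu1 mu_free betaP)) //.
rewrite (@beta_letters_gaps N [:: lX b] w) //.
apply: eq_bigr => k _; apply: eq_bigr => i _; rewrite (bigD1 b) //=.
rewrite conv_letter_cons eqxx mul1r big1 ?addr0 // => a ab.
by rewrite conv_letter_cons eq_sym (inj_eq inl_inj) (negbTE ab) mul0r mulr0.
Qed.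

Lemma block_cumulant_left P : block_cumulant isX beta P = eps P +
  tens2 (delta_cumulant isX beta) (block_cumulant isX beta) (left_delta isX P).
Proof.
rewrite tens2_left_delta epsE /wordext -[RHS]linextD.
apply: (eq_linext_in (V := K^o)) => w _.
exact: (block_wordE mu1 betaP (beta_letters_mixed mu1 mu_free betaP)).
Qed.

Lemma block_cumulant_right P : block_cumulant isX beta P = eps P +
  tens2 (block_cumulant isX beta) (delta_cumulant isX beta) (right_delta isX P).
Proof.
rewrite tens2_right_delta epsE /wordext -[RHS]linextD.
apply: (eq_linext_in (V := K^o)) => w _.
exact: (block_wordEr mu1 betaP (beta_letters_mixed mu1 mu_free betaP)).
Qed.

Definition fdq_term P k : K := \sum_(i : k.-tuple 'I_m)
  beta (letters (lXs i)) *
  tens_ends eps (block_cumulant isY beta) (iter_fdq (lXs i) P).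

Lemma fdq_termS P k : fdq_term P k.+1 =
  wordext (fun w => \sum_(i : k.-tuple 'I_m) \sum_(a : 'I_m)
    beta (letters (lXs (a :: i))) *
    conv (letter_ind K (lX a)) (gaps (lXs i)) w) P.
Proof.
rewrite /fdq_term (big_tuple_cons (fun i => beta (letters (lXs i)) *
  tens_ends eps (block_cumulant isY beta) (iter_fdq (lXs i) P))).
rewrite exchange_big /wordext [RHS](linext_sum (V := K^o)).
apply: eq_bigr => i _; rewrite [RHS](linext_sum (V := K^o)).
apply: eq_bigr => a _; rewrite [RHS](linextZ (V := K^o)).
by congr (_ * _); rewrite [LHS]tens_ends_fdq.
Qed.

Lemma delta_cumulant_fdq P :
  exists2 S : K, has_finsum (fdq_term P) S &
    delta_cumulant isX beta P = eps P + S.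
Proof.
(* No word of P has more than [N] letters to choose, so the terms with k > N vanish. *)
pose N := \max_(w <- msupp P) size (w : seq L).
have sizeN (w : {fmonom L}) : w \in msupp P -> (size w <= N)%N.
  by move=> wP; apply: leq_bigmax_seq.
exists (\sum_(1 <= k < N.+1) fdq_term P k).
  exists N; split=> // -[//|k] Nk; rewrite fdq_termS /wordext.
  rewrite /linext big1_seq // => w /andP[_ /sizeN wN].
  rewrite big1 ?scaler0 // => i _; rewrite big1 // => a _.
  rewrite (@eq_conv_letter _ _ _ _ (fun=> 0)) ?conv0r ?mulr0 // => u uw.
  apply: gaps_small; rewrite size_map size_tuple.
  by rewrite (leq_trans uw) // (leq_trans wN).
rewrite big_add1 big_mkord delta_cumulantE epsE.
rewrite (eq_bigr _ (fun (k : 'I_N) _ => fdq_termS P k)).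
rewrite -[X in _ + X](linext_sum (V := K^o)).
rewrite /wordext -[RHS](linextD (V := K^o)).
apply: (eq_linext_in (V := K^o)) => w wP; congr (_ + _).
exact/delta_word_gaps/sizeN.
Qed.

End TwoAlphabets.

Theorem theorem5p5 (R : realType) (m n : nat)
    (mu : {scalar (ncpoly (complex R) m n)})
    (beta : seq (ncpoly (complex R) m n) -> complex R)
    (mu_unital : mu 1 = 1)
    (mu_free : free_sides isX mu)
    (beta_cumulants : boolean_cumulants mu beta)
    (P : ncpoly (complex R) m n) :
  let X (i : 'I_m) : ncpoly (complex R) m n := letter _ (inl i) in
  let bX := block_cumulant isX beta in
  let bY := block_cumulant isY beta in
  let dX := delta_cumulant isX beta in
  [/\ bX P = eps P + tens2 dX bX (left_delta isX P),
      bX P = eps P + tens2 bX dX (right_delta isX P),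
      exists2 S : complex R,
        has_finsum (fun k =>
          \sum_(i : k.-tuple 'I_m)
             beta [seq X j | j <- i] *
             tens_ends eps bY (iter_fdq [seq inl j | j <- i] P)) S &
        dX P = eps P + S
    & forall x : 'I_m, m = 1%N ->
      exists2 S : complex R,
        has_finsum (fun k =>
          beta (nseq k (X x)) *
          tens_ends eps bY (iter_fdq (nseq k (inl x)) P)) S &
        dX P = eps P + S].
Proof.
move=> X bX bY dX.
have [S [N [F0 SE]] dE] := delta_cumulant_fdq mu_unital mu_free beta_cumulants P.
have termE k : fdq_term beta P k = \sum_(i : k.-tuple 'I_m)
    beta [seq X j | j <- i] *
    tens_ends eps bY (iter_fdq [seq inl j | j <- i] P).
  by apply: eq_bigr => i _; rewrite -map_comp.
split.
- exact: (block_cumulant_left mu_unital mu_free beta_cumulants).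
- exact: (block_cumulant_right mu_unital mu_free beta_cumulants).
- exists S => //; exists N; split=> [k Nk|]; first by rewrite -[RHS](F0 k Nk) termE.
  by rewrite SE; apply: eq_bigr => k _; rewrite termE.
move=> x m1; exists S => //.
(* For m = 1 all indices coincide, and the sum over tuples reduces to the constant tuple. *)
have val0 (a : 'I_m) : a = 0%N :> nat.
  by apply/eqP; rewrite -leqn0 -ltnS -[X in (_ < X)%N]m1.
have term1 k : fdq_term beta P k = beta (nseq k (X x)) *
    tens_ends eps bY (iter_fdq (nseq k (inl x)) P).
  rewrite termE (big_pred1 [tuple of nseq k x]) => [|i].
    by rewrite /= !map_nseq.
  apply/esym/eqP/eq_from_tnth => j; apply: val_inj.
  by rewrite /= !val0.
exists N; split=> [k Nk|]; first by rewrite -[RHS](F0 k Nk) term1.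
by rewrite SE; apply: eq_bigr => k _; rewrite term1.
Qed.
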